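(* For every positive integer $n$, the matrix $B_n = A_n + f(n) I_n$ is completely positive, where $A_n$ is the $n\times n$ matrix with entries $(A_n)_{ij}=(j-i)^2$ and $f(n)=\frac{1}{6}n(n-1)(n+1)$.
   Context: An $n\times n$ real symmetric matrix $A$ is completely positive if $A=BB^T$ for some entrywise non-negative real $n\times k$ matrix $B$ (for some $k$). $I_n$ is the $n\times n$ identity matrix. $A_n$ is the Euclidean distance matrix of $\{1,2,\ldots,n\}$. *)

(* Defs.v *)
From mathcomp Require Import all_boot all_order all_algebra.
From mathcomp Require Import reals.

Set Implicit Arguments.
Unset Strict Implicit.
Unset Printing Implicit Defensive.

Import Order.TTheory GRing.Theory Num.Theory.
Local Open Scope ring_scope.

Definition completely_positive (R : realType) (n : nat) (A : 'M[R]_n) : Prop :=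
  A^T = A /\
  exists (k : nat) (B : 'M[R]_(n, k)),
    (forall i j, 0 <= B i j) /\ A = B *m B^T.

(* The ordinal [i : 'I_n] stands for the point [i.+1] of {1, ..., n}; entries
   are squared distances, with the subtraction taken in [R]. *)
Definition edm (R : realType) (n : nat) : 'M[R]_n :=
  \matrix_(i, j) ((j.+1)%:R - (i.+1)%:R) ^+ 2.

Definition diag_shift (R : realType) (n : nat) : R :=
  1 / 6%:R * n%:R * (n%:R - 1) * (n%:R + 1).

(* Main.v *)
Require Import Defs.
From mathcomp Require Import all_boot all_order all_algebra.
From mathcomp Require Import reals.
From mathcomp Require Import ring lra.
Import Order.TTheory GRing.Theory Num.Theory.
Local Open Scope ring_scope.

(** Centre the points: [x_i = i - (n - 1) / 2], so that the points are symmetric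
    about the origin.  The shift equals [2 * \sum_i x_i ^+ 2], and this is
    exactly the value for which the shifted matrix [B] kills the vector [x].
    Hence every rank-one term [v v^T] of a completely positive decomposition
    has [v] orthogonal to [x], and conversely a matrix that kills [x] is
    determined by its off-diagonal entries (in every row where [x_i <> 0]).
    So only the entries [(x_i - x_j) ^+ 2] with [i != j] have to be matched, by
    nonnegative vectors orthogonal to [x].

    The cheapest such vectors sit on two points of opposite signs.  They
    handle any excess in an entry between opposite signs: a symmetric matrix
    that is nonnegative and kills [x], whose off-diagonal entries vanish except
    between opposite signs, is diagonally dominant after scaling by [|x_i|],
    hence completely positive ([completely_positive_scaled_dominant]).

    What remains is to produce the entries between points of the same sign
    without overshooting the entries between opposite signs.  For [i], [j] on
    one side of the origin and [k] on the other, the vector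
    [e_i + e_j + (|x_i + x_j| / |x_k|) e_k] is nonnegative and orthogonal to
    [x].  Give it the weight [(x_i - x_j) ^+ 2] times a probability of [k]
    proportional to [|x_k| ^+ 3].  The cube is dictated by points near the origin:
    as [x_i] tends to [0], the entry [(i, k)] receives a total tending to
    [x_k ^+ 2], which is all that is allowed.  The sum [triple_part] then has
    the right entries between equal signs, and between points [p] and [- r] its
    entry is [2 (r^2 Phi(p) + p^2 Phi(r)) / E_3], where [E_k] is the sum of
    [|x_i| ^+ k] and [Phi] is [spread].  By [spread_ineq] this is at most
    [(p + r) ^+ 2].  That inequality only needs that the mean of [|x_i| ^+ k]
    is at least the mean [L ^+ k / (k + 1)] of [t ^+ k] over the interval
    [[0, L]], where [L = (n - 1) / 2].

    A point at the origin (for odd [n]) counts as one half on each side; this is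
    achieved by writing the side condition with signs ([side]). *)

(** * The completely positive cone *)
Section Cone.
Context {R : realType} {n : nat}.
Implicit Types (A D : 'M[R]_n) (v : 'cV[R]_n).

Lemma completely_positive0 : completely_positive (0 : 'M[R]_n).
Proof.
split; first exact: trmx0.
by exists 0%N, 0; split=> [i j|]; rewrite ?mul0mx // mxE.
Qed.

Lemma completely_positiveD A D :
  completely_positive A -> completely_positive D -> completely_positive (A + D).
Proof.
move=> [symA [k [P [P0 ->]]]] [symD [l [Q [Q0 ->]]]].
split; first by rewrite linearD /= !trmx_mul !trmxK.
exists (k + l)%N, (row_mx P Q); split; last by rewrite tr_row_mx mul_row_col.
by move=> i j; rewrite mxE; case: (split j).
Qed.

Lemma completely_positive_sum (I : Type) (r : seq I) (P : pred I) (F : I -> 'M[R]_n) :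
  (forall i, P i -> completely_positive (F i)) ->
  completely_positive (\sum_(i <- r | P i) F i).
Proof.
move=> cpF; apply: big_ind => //; first exact: completely_positive0.
exact: completely_positiveD.
Qed.

Lemma completely_positive_rank1 (w : R) v :
  0 <= w -> (forall i, 0 <= v i 0) -> completely_positive (w *: (v *m v^T)).
Proof.
move=> w0 v0; split; first by rewrite linearZ /= trmx_mul trmxK.
exists 1%N, (Num.sqrt w *: v); split.
  by move=> i j; rewrite mxE ord1 mulr_ge0 ?sqrtr_ge0.
by rewrite linearZ /= -scalemxAl -scalemxAr scalerA -expr2 sqr_sqrtr.
Qed.

Lemma sum_delta (a : 'I_n) (F : 'I_n -> R) :
  \sum_i (a == i)%:R * F i = F a.
Proof.
rewrite (bigD1 a) //= eqxx mul1r big1 ?addr0 // => i.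
by rewrite eq_sym => /negPf ->; rewrite mul0r.
Qed.

(** The two-point vectors [y_j e_i + y_i e_j], with weight
    [D i j / (y_i y_j)], reproduce the off-diagonal entries; the diagonal they
    use in row [i] is the sum of [D i j * y_j / y_i], so that dominance leaves a
    nonnegative diagonal remainder. *)
Lemma completely_positive_scaled_dominant D (y : 'I_n -> R) :
  D^T = D -> (forall i, 0 < y i) ->
  (forall i j, i != j -> 0 <= D i j) ->
  (forall i, \sum_(j | j != i) D i j * y j <= D i i * y i) ->
  completely_positive D.
Proof.
move=> symD y0 D0 dom.
(* The off-diagonal part of [D], defined on all pairs so that sums over ordered
   pairs need no side condition; each unordered pair is counted twice, whence
   the factor 2 in the weights. *)
pose o i j := if j != i then D i j else 0.
have o0 i j : 0 <= o i j by rewrite /o; case: eqVneq => //= ij; rewrite D0 // eq_sym.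
have symo i j : o i j = o j i by rewrite /o eq_sym -{1}symD mxE.
pose u i j : 'cV[R]_n := \col_a ((a == i)%:R * y j + (a == j)%:R * y i).
pose e i : 'cV[R]_n := \col_a (a == i)%:R.
pose slack i := D i i - \sum_j o i j * y j / y i.
suff -> : D = \sum_i \sum_j (o i j / (2 * y i * y j)) *: (u i j *m (u i j)^T)
              + \sum_i slack i *: (e i *m (e i)^T).
  apply: completely_positiveD; apply: completely_positive_sum => i _.
    apply: completely_positive_sum => j _; apply: completely_positive_rank1.
      by rewrite divr_ge0 // !mulr_ge0 // ltW.
    by move=> a; rewrite mxE addr_ge0 // mulr_ge0 // ltW.
  apply: completely_positive_rank1 => [|a]; last by rewrite mxE.
  rewrite subr_ge0 -mulr_suml ler_pdivrMr // (le_trans _ (dom i)) //.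
  rewrite [leRHS]big_mkcond /= le_eqVlt; apply/orP; left; apply/eqP.
  by apply: eq_bigr => j _; rewrite /o; case: ifP; rewrite ?mul0r.
apply/matrixP => a b; rewrite mxE !summxE.
have -> : \sum_i (slack i *: (e i *m (e i)^T)) a b = (a == b)%:R * slack a.
  transitivity (\sum_i (a == i)%:R * ((b == i)%:R * slack i)).
    by apply: eq_bigr => i _; rewrite !mxE big_ord1 !mxE; ring.
  by rewrite sum_delta eq_sym.
have -> : \sum_i (\sum_j (o i j / (2 * y i * y j)) *: (u i j *m (u i j)^T)) a b
   = o a b + (a == b)%:R * \sum_j o a j * y j / y a.
  transitivity (\sum_i ((a == i)%:R * ((b == i)%:R * \sum_j o i j * y j / y i / 2)
     + (a == i)%:R * \sum_j (b == j)%:R * (o i j / 2)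
     + (b == i)%:R * \sum_j (a == j)%:R * (o i j / 2)
     + \sum_j (a == j)%:R * ((b == j)%:R * (o i j * y i / y j / 2)))).
    apply: eq_bigr => i _; rewrite summxE !mulr_sumr -!big_split /=.
    apply: eq_bigr => j _; rewrite !mxE big_ord1 !mxE.
    have yi : y i != 0 by rewrite gt_eqF.
    have yj : y j != 0 by rewrite gt_eqF.
    by field; rewrite yi yj.
  rewrite !big_split /= !sum_delta (exchange_big_dep xpredT) //=.
  under [X in _ + X]eq_bigr => j _ do rewrite -!mulr_sumr.
  rewrite !sum_delta (eq_sym b a) (symo b a).
  have -> : \sum_i o i a * y i / y a / 2 = \sum_j o a j * y j / y a / 2.
    by apply: eq_bigr => i _; rewrite symo.
  by rewrite -!mulr_suml; field; rewrite gt_eqF.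
rewrite /slack /o; case: eqVneq => [->|ba]; rewrite ?eqxx /=; ring.
Qed.

End Cone.

(** * Sums of rank-one matrices supported on three indices *)
Section Triples.
Context {R : realType} {n : nat}.

Definition triple_vec (c : 'I_n -> 'I_n -> 'I_n -> R) (i j k : 'I_n) : 'cV[R]_n :=
  \col_a ((a == i)%:R + (a == j)%:R + (a == k)%:R * c i j k).

(** Expansion of the nine products of the three unit vectors.  The last
    summand collects the products of a unit vector with itself, which
    only reach the diagonal. *)
Lemma triple_sumE (w c : 'I_n -> 'I_n -> 'I_n -> R) (a b : 'I_n) :
  (forall i j k, w i j k = w j i k) -> (forall i j k, c i j k = c j i k) ->
  (\sum_i \sum_j \sum_k w i j k *: (triple_vec c i j k *m (triple_vec c i j k)^T)) a b
  = 2 * \sum_k w a b k + 2 * \sum_j w a j b * c a j b + 2 * \sum_j w b j a * c b j a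
    + (a == b)%:R * (2 * \sum_j \sum_k w a j k + \sum_i \sum_j w i j a * c i j a ^+ 2).
Proof.
move=> symw symc.
pose d (i j : 'I_n) : R := (i == j)%:R.
transitivity (
   \sum_i (d a i * (d b i * \sum_j \sum_k w i j k))
 + \sum_i (d a i * \sum_j d b j * \sum_k w i j k)
 + \sum_i (d a i * \sum_j \sum_k d b k * (w i j k * c i j k))
 + \sum_i (d b i * \sum_j d a j * \sum_k w i j k)
 + \sum_i (\sum_j d a j * (d b j * \sum_k w i j k))
 + \sum_i (\sum_j d a j * \sum_k d b k * (w i j k * c i j k))
 + \sum_i (d b i * \sum_j \sum_k d a k * (w i j k * c i j k))
 + \sum_i (\sum_j d b j * \sum_k d a k * (w i j k * c i j k))
 + \sum_i (\sum_j \sum_k d a k * (d b k * (w i j k * c i j k ^+ 2)))).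
  rewrite summxE -!big_split /=; apply: eq_bigr => i _.
  rewrite summxE !mulr_sumr -!big_split /=; apply: eq_bigr => j _.
  rewrite summxE !mulr_sumr -!big_split /=; apply: eq_bigr => k _.
  by rewrite !mxE big_ord1 !mxE /d; ring.
rewrite /d !sum_delta.
have dd (F : 'I_n -> 'I_n -> R) z : \sum_i \sum_j (z == j)%:R * F i j = \sum_i F i z.
  by apply: eq_bigr => i _; rewrite sum_delta.
rewrite !dd.
have -> : \sum_i \sum_j \sum_k (a == k)%:R * ((b == k)%:R * (w i j k * c i j k ^+ 2))
  = \sum_i \sum_j (b == a)%:R * (w i j a * c i j a ^+ 2).
  by apply: eq_bigr => i _; rewrite dd.
have -> : \sum_i (b == a)%:R * (\sum_k w i a k) = (b == a)%:R * \sum_j \sum_k w a j k.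
  rewrite -mulr_sumr; congr (_ * _); apply: eq_bigr => j _.
  by apply: eq_bigr => k _; rewrite symw.
under [X in _ + X = _]eq_bigr => i _ do rewrite -mulr_sumr.
rewrite -mulr_sumr (eq_sym b a).
have sw z t : \sum_i w i z t * c i z t = \sum_j w z j t * c z j t.
  by apply: eq_bigr => i _; rewrite symw symc.
have -> : \sum_k w b a k = \sum_k w a b k by apply: eq_bigr => k _; rewrite symw.
rewrite ?dd ?sw.
by ring.
Qed.

End Triples.

(** * The centred points and their absolute moments *)
Section Points.
Context {R : realType}.
Implicit Types (n : nat) (g : R -> R).

Definition centred {n} (i : 'I_n) : R := i%:R - (n%:R - 1) / 2.

Definition absmoment n (k : nat) : R := \sum_(i < n) `|centred i| ^+ k.

Lemma absmoment_ge0 n k : 0 <= absmoment n k.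
Proof. by apply: sumr_ge0 => i _; rewrite exprn_ge0. Qed.

Lemma centred_rev n (i : 'I_n) : centred (rev_ord i) = - centred i.
Proof.
rewrite /centred /= natrB ?ltn_ord // -natr1; by field.
Qed.

Lemma sum_centred_rev n g : \sum_(i < n) g (centred i) = \sum_(i < n) g (- centred i).
Proof.
rewrite (reindex_inj rev_ord_inj) /=.
by apply: eq_bigr => i _; rewrite centred_rev.
Qed.

Lemma sum_centred_odd n g : (forall t, g (- t) = - g t) -> \sum_(i < n) g (centred i) = 0.
Proof.
move=> oddg; have := sum_centred_rev n g.
under [X in _ = X -> _]eq_bigr => i _ do rewrite oddg.
rewrite sumrN => h; lra.
Qed.

(** Passing from [n] to [n + 2] points keeps the old centred points and adds one
    at each end; this is why the moments are handled by induction in steps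
    of two. *)
Lemma sum_centred_step n g :
  \sum_(i < n.+2) g (centred i) =
  \sum_(i < n) g (centred i) + (g (n.+1%:R / 2) + g (- (n.+1%:R / 2))).
Proof.
rewrite big_ord_recl big_ord_recr /=.
have -> : centred (@ord0 n.+1) = - (n.+1%:R / 2).
  by rewrite /centred /= -(natr1 n.+1) -(natr1 n); field.
have -> : centred (lift ord0 (@ord_max n)) = n.+1%:R / 2.
  by rewrite /centred /= -(natr1 n.+1) -(natr1 n); field.
rewrite (eq_bigr (fun i : 'I_n => g (centred i))); first by ring.
move=> i _; congr (g _); rewrite /centred /= /bump /= -(natr1 n.+1) -(natr1 n); by field.
Qed.

Lemma absmoment_step n k : absmoment n.+2 k = absmoment n k + 2 * (n.+1%:R / 2) ^+ k.
Proof.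
rewrite /absmoment (sum_centred_step _ (fun t => `|t| ^+ k)) normrN ger0_norm ?divr_ge0 //.
ring.
Qed.

Lemma absmoment0n k : absmoment 0 k = 0.
Proof. by rewrite /absmoment big_ord0. Qed.

Lemma absmoment1n k : absmoment 1 k.+1 = 0.
Proof. by rewrite /absmoment big_ord1 /centred /= subrr mul0r subrr normr0 expr0n. Qed.

Lemma two_step_ind (P : nat -> Prop) :
  P 0%N -> P 1%N -> (forall n, P n -> P n.+2) -> forall n, P n.
Proof.
move=> P0 P1 PS n; suff : P n /\ P n.+1 by case.
by elim: n => [|n [Pn PSn]]; split=> //; apply: PS.
Qed.

Lemma absmoment0 n : absmoment n 0 = n%:R.
Proof.
by rewrite /absmoment; under eq_bigr do rewrite expr0; rewrite sumr_const card_ord.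
Qed.

(** With [L = (n - 1) / 2], this bound and the one on the third moment read
    [n * L ^+ k <= (k + 1) * absmoment n k]: the average absolute moments of the
    points are at least those of the uniform distribution on [[- L, L]]. *)
Lemma absmoment1_ge n : n%:R * (n%:R - 1) <= 4 * absmoment n 1.
Proof.
elim/two_step_ind: n => [||n IH]; rewrite ?absmoment0n ?absmoment1n; [lra|lra|].
rewrite absmoment_step expr1 -(natr1 n.+1) -(natr1 n); have := ler0n R n; nra.
Qed.

(** An exact value, because the diagonal shift is twice this moment. *)
Lemma absmoment2 n : absmoment n 2 = n%:R * (n%:R ^+ 2 - 1) / 12.
Proof.
elim/two_step_ind: n => [||n IH]; rewrite ?absmoment0n ?absmoment1n; [by field|by field|].
by rewrite absmoment_step IH -(natr1 n.+1) -(natr1 n); field.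
Qed.

Lemma absmoment3_ge n : n%:R * (n%:R - 1) ^+ 3 <= 32 * absmoment n 3.
Proof.
elim/two_step_ind: n => [||n IH]; rewrite ?absmoment0n ?absmoment1n; [lra|lra|].
rewrite absmoment_step mulrDr -(natr1 n.+1) -(natr1 n); have := ler0n R n; move: IH.
set t : R := n%:R => IH t0.
have -> : 32 * (2 * ((t + 1) / 2) ^+ 3) = t * (t - 1) ^+ 3 + 8 * (t + 1) ^+ 3 - t * (t - 1) ^+ 3.
  by field.
have : 0 <= t * t by rewrite mulr_ge0.
nra.
Qed.

Lemma norm_centred_le n (i : 'I_n) : `|centred i| <= (n%:R - 1) / 2.
Proof.
have : (i.+1)%:R <= n%:R :> R by rewrite ler_nat ltn_ord.
have : 0 <= i%:R :> R by [].
by rewrite ler_norml /centred -natr1 => h1 h2; apply/andP; split; lra.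
Qed.

(** Up to a factor that depends only on the other point, what the triples pairing
    a point at distance [p] from the origin with the points on its own side take
    from the entry joining it to a point on the other side; the factor one half
    restricts a sum over all points to one side. *)
Definition spread n (p : R) : R :=
  (\sum_(j < n) (p - `|centred j|) ^+ 2 * (p + `|centred j|)) / 2.

Lemma spreadE n p :
  2 * spread n p = absmoment n 3 - p * absmoment n 2 - p ^+ 2 * absmoment n 1 + p ^+ 3 * n%:R.
Proof.
rewrite /spread mulrC divfK ?pnatr_eq0 // -[n%:R]absmoment0 /absmoment.
rewrite !mulr_sumr -!sumrB -big_split /=.
by apply: eq_bigr => j _; rewrite expr0 expr1; ring.
Qed.

(** By [spreadE] the terms in [absmoment n 3] alone give
    [absmoment n 3 * (p ^+ 2 + r ^+ 2)].  The rest is divisible by [p * r], and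
    the claim becomes
    [p r (p + r) n <= 2 E_3 + (p + r) E_2 + 2 p r E_1].  Inserting the lower
    bounds on the moments leaves the inequality [key] between polynomials in
    [p], [r] and [L], which holds for [p] and [r] in [[0, L]]. *)
Lemma spread_ineq n (p r : R) :
  0 <= p <= (n%:R - 1) / 2 -> 0 <= r <= (n%:R - 1) / 2 ->
  2 * (r ^+ 2 * spread n p + p ^+ 2 * spread n r) <= absmoment n 3 * (p + r) ^+ 2.
Proof.
set L := (n%:R - 1) / 2 => /andP[p0 pL] /andP[r0 rL].
have N0 : 0 <= n%:R :> R by [].
have M1 : n%:R * L <= 2 * absmoment n 1.
  by have := absmoment1_ge n; rewrite /L; lra.
have M2 : n%:R * L ^+ 2 <= 3 * absmoment n 2.
  rewrite absmoment2 /L.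
  have : 0 <= n%:R * L by rewrite mulr_ge0 // (le_trans p0).
  rewrite /L; nra.
have M3 : n%:R * L ^+ 3 <= 4 * absmoment n 3.
  by have := absmoment3_ge n; rewrite /L; lra.
have -> : 2 * (r ^+ 2 * spread n p + p ^+ 2 * spread n r) =
    r ^+ 2 * (2 * spread n p) + p ^+ 2 * (2 * spread n r) by ring.
rewrite !spreadE.
set E3 := absmoment n 3 in M3 *; set E2 := absmoment n 2 in M2 *.
set E1 := absmoment n 1 in M1 *; set N : R := n%:R in N0 M1 M2 M3 *.
clearbody E1 E2 E3 N L.
have pr0 : 0 <= p * r by rewrite mulr_ge0.
have key : p * r * (p + r) <= L ^+ 3 / 2 + (p + r) * (L ^+ 2 / 3) + 2 * p * r * (L / 2).
  have L0 : 0 <= L by lra.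
  (* [p * r] is at most the product of [L] with either of [p] and [r]. *)
  have h1 : 2 * (p * r) <= L * (p + r) by nra.
  have [h|h] := leP (p + r) L.
    have : p * r * (p + r) <= p * r * L by rewrite ler_wpM2l.
    have : 0 <= L ^+ 3 by rewrite exprn_ge0.
    have : 0 <= (p + r) * L ^+ 2 by rewrite mulr_ge0 ?exprn_ge0 // addr_ge0.
    by lra.
  have h2 : 2 * (p * r) * (p + r - L) <= L * (p + r) * (p + r - L).
    by rewrite ler_wpM2r // subr_ge0 ltW.
  have h3 : L * (p + r) * (p + r - L) <= L * (p + r) * L.
    rewrite ler_wpM2l ?mulr_ge0 ?addr_ge0 //; lra.
  have h4 : L ^+ 2 * (p + r) <= L ^+ 2 * (2 * L) by rewrite ler_wpM2l ?exprn_ge0 //; lra.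
  have -> : L ^+ 3 = L ^+ 2 * L by ring.
  move: h2 h3 h4; nra.
have k3 : N * L ^+ 3 / 2 <= 2 * E3 by lra.
have k2 : N * ((p + r) * (L ^+ 2 / 3)) <= (p + r) * E2.
  have -> : N * ((p + r) * (L ^+ 2 / 3)) = (p + r) * (N * L ^+ 2 / 3) by ring.
  by apply: ler_wpM2l; [exact: addr_ge0 | lra].
have k1 : N * (2 * p * r * (L / 2)) <= 2 * (p * r) * E1.
  have -> : N * (2 * p * r * (L / 2)) = 2 * (p * r) * (N * L / 2) by ring.
  by apply: ler_wpM2l; [lra | lra].
have k : N * (p * r * (p + r)) <= 2 * E3 + (p + r) * E2 + 2 * (p * r) * E1.
  have := ler_wpM2l N0 key; rewrite !mulrDr; lra.
have := ler_wpM2l pr0 k.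
rewrite -subr_ge0 => h; rewrite -subr_ge0; apply: le_trans h _.
rewrite le_eqVlt; apply/orP; left; apply/eqP; ring.
Qed.

End Points.

(** * The contribution of balanced triples *)
Section Decomposition.
Context {R : realType}.
Implicit Types (a b c : R).

(** With [h t = (1 + sg t) / 2], this is
    [h a * h b * h (- c) + h (- a) * h (- b) * h c]: the indicator that [a] and
    [b] lie on one side of the origin and [c] on the other, where the origin
    belongs by one half to each side.  The expanded form is affine in the sign
    of each argument, so that sums of it over the points are easy
    ([sum_centred_norm]). *)
Definition side a b c : R :=
  (1 + Num.sg a * Num.sg b - Num.sg c * Num.sg a - Num.sg c * Num.sg b) / 4.

Lemma sg_cases a :
  (0 < a /\ Num.sg a = 1) \/ ((a < 0 /\ Num.sg a = -1) \/ (a = 0 /\ Num.sg a = 0)).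
Proof.
have [a0|a0|->] := ltrgtP a 0; last by right; right; rewrite sgr0.
  by right; left; rewrite ltr0_sg.
by left; rewrite gtr0_sg.
Qed.

Lemma side_ge0 a b c : 0 <= side a b c.
Proof.
rewrite /side.
by case: (sg_cases a) => [[_ ->]|[[_ ->]|[_ ->]]];
  case: (sg_cases b) => [[_ ->]|[[_ ->]|[_ ->]]];
  case: (sg_cases c) => [[_ ->]|[[_ ->]|[_ ->]]]; lra.
Qed.

Lemma sideC a b c : side a b c = side b a c.
Proof. by rewrite /side; ring. Qed.

Lemma side_eq0_or a b c :
  side a b c = 0 \/ (0 <= a /\ 0 <= b /\ c <= 0) \/ (a <= 0 /\ b <= 0 /\ 0 <= c).
Proof.
rewrite /side.
by case: (sg_cases a) => [[? ->]|[[? ->]|[? ->]]];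
  case: (sg_cases b) => [[? ->]|[[? ->]|[? ->]]];
  case: (sg_cases c) => [[? ->]|[[? ->]|[? ->]]];
  first [left; lra | right; left; lra | right; right; lra].
Qed.

Lemma side_balanced a b c : c != 0 -> side a b c * (a + b + `|a + b| / `|c| * c) = 0.
Proof.
move=> c0.
case: (side_eq0_or a b c) => [->|[[a0 [b0 c0']]|[a0 [b0 c0']]]]; first by rewrite mul0r.
  by rewrite ger0_norm ?addr_ge0 // ler0_norm //; field.
rewrite ler0_norm; last by rewrite -oppr_ge0 opprD addr_ge0 ?oppr_ge0.
by rewrite ger0_norm //; field.
Qed.

(** Where [side] does not vanish, [a] and [b] do not have opposite signs. *)
Lemma side_norm a b c :
  side a b c * ((a - b) ^+ 2 * `|a + b|) = side a b c * ((`|a| - `|b|) ^+ 2 * (`|a| + `|b|)).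
Proof.
case: (side_eq0_or a b c) => [->|[[a0 [b0 _]]|[a0 [b0 _]]]]; first by rewrite !mul0r.
  by rewrite !ger0_norm ?addr_ge0.
rewrite !ler0_norm //; last by rewrite -oppr_ge0 opprD addr_ge0 ?oppr_ge0.
by congr (_ * _); ring.
Qed.

(** The sign part is odd and cancels over the symmetric points. *)
Lemma sum_centred_norm n (al be : R) (g : R -> R) :
  \sum_(i < n) (al + be * Num.sg (centred i)) * g `|centred i| = al * \sum_(i < n) g `|centred i|.
Proof.
under eq_bigr => i _ do rewrite mulrDl -mulrA.
rewrite big_split /= -!mulr_sumr.
rewrite (sum_centred_odd _ (fun t => Num.sg t * g `|t|)) ?mulr0 ?addr0 // => t.
by rewrite sgrN normrN mulNr.
Qed.

Context {n : nat}.
Local Notation x := (@centred R n).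
Local Notation E3 := (@absmoment R n 3).
Local Notation s i := (Num.sg (x i)).

Definition weight (i j k : 'I_n) : R :=
  side (x i) (x j) (x k) * (x i - x j) ^+ 2 * `|x k| ^+ 3 / E3.

Definition coef (i j k : 'I_n) : R := `|x i + x j| / `|x k|.

Definition triple_part : 'M[R]_n :=
  \sum_i \sum_j \sum_k weight i j k *: (triple_vec coef i j k *m (triple_vec coef i j k)^T).

Lemma triple_part_cp : completely_positive triple_part.
Proof.
do 3!(apply: completely_positive_sum => ? _).
apply: completely_positive_rank1.
  apply: divr_ge0; last exact: absmoment_ge0.
  by apply: mulr_ge0; [apply: mulr_ge0; [exact: side_ge0 | exact: sqr_ge0] | exact: exprn_ge0].
by move=> a; rewrite mxE !addr_ge0 // mulr_ge0 // divr_ge0.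
Qed.

Lemma weightC i j k : weight i j k = weight j i k.
Proof. by rewrite /weight sideC -opprB sqrrN. Qed.

Lemma coefC i j k : coef i j k = coef j i k.
Proof. by rewrite /coef addrC. Qed.

Lemma weight_balanced i j k : weight i j k * (x i + x j + coef i j k * x k) = 0.
Proof.
have [xk0|xk0] := eqVneq (x k) 0.
  by rewrite /weight xk0 normr0 expr0n mulr0 !mul0r.
transitivity ((x i - x j) ^+ 2 * `|x k| ^+ 3 / E3 *
  (side (x i) (x j) (x k) * (x i + x j + `|x i + x j| / `|x k| * x k))).
  by rewrite /weight /coef; ring.
by rewrite side_balanced // mulr0.
Qed.

(** Each vector with nonzero weight is orthogonal to the points. *)
Lemma triple_part_kernel (a : 'I_n) : \sum_(b < n) triple_part a b * x b = 0.
Proof.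
under eq_bigr => b _ do rewrite summxE mulr_suml.
rewrite exchange_big big1 //= => i _.
under eq_bigr => b _ do rewrite summxE mulr_suml.
rewrite exchange_big big1 //= => j _.
under eq_bigr => b _ do rewrite summxE mulr_suml.
rewrite exchange_big big1 //= => k _.
transitivity (triple_vec coef i j k a 0 * \sum_b ((i == b)%:R * (weight i j k * x b)
  + (j == b)%:R * (weight i j k * x b) + (k == b)%:R * (weight i j k * coef i j k * x b))).
  rewrite mulr_sumr; apply: eq_bigr => b _.
  rewrite [LHS](_ : _ = weight i j k *
    (triple_vec coef i j k a 0 * triple_vec coef i j k b 0) * x b);
    last by rewrite mxE mxE big_ord1 [_^T _ _]mxE.
  rewrite [triple_vec coef i j k b 0]mxE !(eq_sym b); ring.
rewrite !big_split /= !sum_delta -mulrA -!mulrDr weight_balanced; exact: mulr0.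
Qed.

(** The quotient [E3 / E3] is [1], except that it is [0] when all points are at
    the origin. *)
Lemma sum_weight i j :
  \sum_k weight i j k = (1 + s i * s j) / 4 * (x i - x j) ^+ 2 * (E3 / E3).
Proof.
transitivity (\sum_k ((1 + s i * s j) / 4 - (s i + s j) / 4 * s k) * (`|x k| ^+ 3
    * ((x i - x j) ^+ 2 / E3))).
  by apply: eq_bigr => k _; rewrite /weight /side; ring.
under eq_bigr do rewrite -mulNr.
rewrite (sum_centred_norm _ _ _ (fun t => t ^+ 3 * _)) -mulr_suml /absmoment; ring.
Qed.

Lemma sum_weight_coef i k :
  2 * (\sum_j weight i j k * coef i j k)
  = (1 - s i * s k) * x k ^+ 2 * spread n `|x i| / E3.
Proof.
pose F t := (`|x i| - t) ^+ 2 * (`|x i| + t).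
transitivity (2 * \sum_j ((1 - s i * s k) / 4 + (s i - s k) / 4 * s j)
    * (F `|x j| * (x k ^+ 2 / E3))).
  congr (2 * _); apply: eq_bigr => j _.
  have [xk0|xk0] := eqVneq (x k) 0.
    by rewrite /weight xk0 normr0 !expr0n /= !(mulr0, mul0r).
  transitivity (side (x i) (x j) (x k) * ((x i - x j) ^+ 2 * `|x i + x j|) * (x k ^+ 2 / E3)).
    rewrite /weight /coef -(real_normK (num_real (x k))).
    have nk : `|x k| != 0 by rewrite normr_eq0.
    have -> : `|x k| ^+ 3 = `|x k| ^+ 2 * `|x k| by ring.
    rewrite -[RHS]mulr1 -(mulfV nk); ring.
  by rewrite side_norm /side /F; ring.
by rewrite (sum_centred_norm _ _ _ (fun t => F t * _)) -mulr_suml /spread /F; set q := E3^-1; field.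
Qed.

(** Between equal nonzero signs only the first summand survives, and it is the
    squared distance; between opposite signs only the second does. *)
Lemma triple_part_offdiag (a b : 'I_n) : a != b -> E3 != 0 ->
  triple_part a b = (1 + s a * s b) / 2 * (x a - x b) ^+ 2
    + (1 - s a * s b) * (x b ^+ 2 * spread n `|x a| + x a ^+ 2 * spread n `|x b|) / E3.
Proof.
move=> ab E3n0; rewrite /triple_part (triple_sumE _ _ _ _ weightC coefC).
by rewrite (negPf ab) mul0r addr0 sum_weight !sum_weight_coef; field.
Qed.

(** At the origin, orthogonality to the points says nothing about the diagonal
    entry, so it is bounded directly. *)
Lemma triple_part_diag0 (a : 'I_n) : x a = 0 -> triple_part a a <= absmoment n 2 / 2.
Proof.
move=> xa0; rewrite /triple_part (triple_sumE _ _ _ _ weightC coefC) eqxx.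
rewrite sum_weight !sum_weight_coef xa0 [X in _ + X](_ : _ = 
  absmoment n 2 / 2 * (E3 / E3)).
  have E2 := @absmoment_ge0 R n 2.
  rewrite subrr expr0n /= !(mulr0, mul0r, add0r).
  have [->|E3n0] := eqVneq E3 0; first by rewrite !(mulr0, mul0r) divr_ge0.
  by rewrite mulfV // mulr1.
rewrite [X in _ + X]big1 => [|i _]; last first.
  by apply: big1 => j _; rewrite /weight xa0 normr0 expr0n /= !(mulr0, mul0r).
rewrite addr0 mul1r; under eq_bigr => j _ do
  rewrite sum_weight xa0 sgr0 mul0r addr0 sub0r sqrrN -[_ ^+ 2]real_normK ?num_real //
    -mulrA [_ ^+ 2 * _]mulrC mulrA.
set q := E3 / E3; by rewrite -mulr_sumr /absmoment; field.
Qed.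

Lemma absmoment3_gt0 (a b : 'I_n) : a != b -> 0 < E3.
Proof.
move=> ab; have n1 : (2 <= n)%N.
  by case: n a b ab => [[]//|[|//]] a b; rewrite !ord1 eqxx.
have n2 : 2 <= n%:R :> R by rewrite (ler_nat _ 2).
have : 0 < n%:R * (n%:R - 1) ^+ 3 :> R.
  by apply: mulr_gt0; [|apply: exprn_gt0]; lra.
have := @absmoment3_ge R n; lra.
Qed.

End Decomposition.

(** * Decomposition of the shifted distance matrix *)
Lemma shifted_edmE (R : realType) n (a b : 'I_n) :
  (edm R n + diag_shift R n *: 1%:M) a b =
  (centred a - centred b) ^+ 2 + 2 * absmoment n 2 * (a == b)%:R.
Proof.
rewrite !mxE absmoment2 /diag_shift /centred -!(natr1 (nat_of_ord _)) mulr_natr.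
case: (a == b); rewrite ?mulr1n ?mulr0n; by field.
Qed.

Lemma shifted_edm_kernel (R : realType) n (a : 'I_n) :
  \sum_b (edm R n + diag_shift R n *: 1%:M) a b * centred b = 0.
Proof.
pose x (i : 'I_n) : R := centred i.
(* [absmoment n 2] is made opaque so that products are not distributed into its
   defining sum. *)
have [m mE] : {m : R | m = absmoment n 2} by exists (absmoment n 2).
transitivity (\sum_(b < n) ((a == b)%:R * (2 * m * x b))
  + x a ^+ 2 * (\sum_(b < n) x b) + \sum_(b < n) x b ^+ 3
  - 2 * x a * \sum_(b < n) `|x b| ^+ 2).
  rewrite !mulr_sumr -!sumrN -!big_split /=; apply: eq_bigr => b _.
  by rewrite shifted_edmE -mE real_normK ?num_real // /x; ring.
rewrite sum_delta (sum_centred_odd _ id) // (sum_centred_odd _ (fun t => t ^+ 3)).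
  by rewrite mE /absmoment /x; ring.
by move=> t; ring.
Qed.

Theorem theorem9 (R : realType) (n : nat) (hn : (0 < n)%N) :
  completely_positive (edm R n + diag_shift R n *: 1%:M).
Proof.
set B := edm R n + _.
have [symC _] := @triple_part_cp R n.
have symB : B^T = B.
  by apply/matrixP => i j; rewrite mxE !shifted_edmE eq_sym -opprB sqrrN.
rewrite -[B](subrK triple_part); apply: completely_positiveD; last exact: triple_part_cp.
pose x (i : 'I_n) : R := centred i.
(* The row of [B - triple_part] at the origin vanishes off the diagonal, so any
   positive scaling will do there. *)
pose y i := if x i == 0 then 1 else `|x i|.
have DE i j : (B - triple_part) i j = B i j - triple_part i j.
  by rewrite mxE; congr (_ + _); rewrite mxE.
have offdiag i j : i != j -> (B - triple_part) i j = (1 - Num.sg (x i) * Num.sg (x j)) / 2 *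
   ((x i - x j) ^+ 2 - 2 * (x j ^+ 2 * spread n `|x i| + x i ^+ 2 * spread n `|x j|)
      / absmoment n 3).
  move=> ij; have E3 := @absmoment3_gt0 R n i j ij.
  rewrite DE shifted_edmE triple_part_offdiag ?(gt_eqF E3) // (negPf ij) mulr0 /x.
  by field; rewrite gt_eqF.
have offdiag0 i j : i != j -> 0 <= x i * x j -> (B - triple_part) i j = 0.
  (* [2 * spread n 0] is the third moment: at the origin the triples exactly
     exhaust the entry. *)
  have zero k l : k != l -> x k = 0 -> (B - triple_part) k l = 0.
    move=> kl xk; have E3 := @absmoment3_gt0 R n k l kl.
    rewrite offdiag // xk normr0 -[x l ^+ 2]real_normK ?num_real //.
    have := @spreadE R n 0; rewrite !expr0n /= !mul0r !subr0 addr0 => sp.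
    rewrite [2 * _](_ : _ = `|x l| ^+ 2 * (2 * spread n 0)); last by ring.
    rewrite sp mulfK ?(gt_eqF E3) // real_normK ?num_real //; ring.
  move=> ij; case: (sg_cases (x i)) => [[xi si]|[[xi si]|[xi _ _]]]; last exact: zero.
    rewrite pmulr_rge0 // => xj; move: xj; rewrite le_eqVlt => /predU1P[/esym xj|xj].
      by rewrite -[B - _]trmxK linearB /= symB symC mxE zero // eq_sym.
    by rewrite offdiag // si gtr0_sg // mulr1 subrr !mul0r.
  rewrite nmulr_rge0 // => xj; move: xj; rewrite le_eqVlt => /predU1P[xj|xj].
    by rewrite -[B - _]trmxK linearB /= symB symC mxE zero // eq_sym.
  by rewrite offdiag // si ltr0_sg // mulrNN mulr1 subrr !mul0r.
apply: (completely_positive_scaled_dominant _ y).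
- by rewrite linearB /= symB symC.
- by move=> i; rewrite /y; case: eqVneq => // xi; rewrite normr_gt0.
- move=> i j ij; have [|xx] := leP 0 (x i * x j); first by move=> h; rewrite offdiag0.
  have E3 := @absmoment3_gt0 R n i j ij.
  have sg0 : Num.sg (x i) * Num.sg (x j) = -1 by rewrite -sgrM ltr0_sg.
  rewrite offdiag // sg0 mulr_ge0 ?subr_ge0 ?ler_pdivrMr //; first by lra.
  have -> : (x i - x j) ^+ 2 = (`|x i| + `|x j|) ^+ 2.
    have : `|x i| * `|x j| = - (x i * x j) by rewrite -normrM ltr0_norm.
    move=> nxx; transitivity (`|x i| ^+ 2 + 2 * (`|x i| * `|x j|) + `|x j| ^+ 2); last by ring.
    by rewrite nxx !real_normK ?num_real //; ring.
  rewrite [leRHS]mulrC.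
  rewrite -[x i ^+ 2]real_normK ?num_real // -[x j ^+ 2]real_normK ?num_real //.
  by apply: spread_ineq; rewrite normr_ge0 norm_centred_le.
move=> i; rewrite {2}/y; have [xi|xi] := eqVneq (x i) 0.
  rewrite big1 => [|j ji]; last by rewrite offdiag0 ?mul0r // 1?eq_sym // xi mul0r.
  rewrite mulr1 DE subr_ge0 (le_trans (triple_part_diag0 _ xi)) //.
  rewrite shifted_edmE subrr eqxx expr0n /= mulr1; have := @absmoment_ge0 R n 2; lra.
(* Away from the origin the row is orthogonal to [x], and its off-diagonal
   entries only meet points of the opposite sign: dominance is an equality. *)
have : \sum_j (B - triple_part) i j * x j = 0.
  under eq_bigr => j _ do rewrite DE mulrBl.
  by rewrite sumrB shifted_edm_kernel triple_part_kernel subrr.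
rewrite (bigD1 i) //= => /eqP; rewrite addr_eq0 => /eqP ker.
have sgi : Num.sg (x i) * Num.sg (x i) = 1 by rewrite -sgrM gtr0_sg // -expr2 exprn_even_gt0.
rewrite [leRHS](_ : _ = Num.sg (x i) * ((B - triple_part) i i * x i)); last first.
  by rewrite normrEsg; ring.
rewrite ker mulrN mulr_sumr le_eqVlt; apply/orP; left; apply/eqP; rewrite -[RHS]sumrN.
apply: eq_bigr => j ji; have [h|xx] := leP 0 (x i * x j).
  by rewrite offdiag0 1?eq_sym // !(mul0r, oppr0, mulr0).
have xj : x j != 0 by apply: contraTneq xx => ->; rewrite mulr0 ltxx.
have sg0 : Num.sg (x i) * Num.sg (x j) = -1 by rewrite -sgrM ltr0_sg.
rewrite /y (negPf xj) normrEsg.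
have -> : Num.sg (x j) = - Num.sg (x i).
  by rewrite -[LHS]mul1r -sgi -mulrA sg0 mulrN1.
ring.
Qed.
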